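(* Let $A \in \mathbb{C}_{n,m}$ and $D, E \in \mathbb{C}_{m,n}$. The following statements are equivalent. (i) The matrix $A$ is $(D, E)$-invertible. (ii) The outer inverse $A^{(2)}_{\mathcal{R}(D), \mathcal{N}(E)}$ exists. Furthermore, in this case $A^{\parallel (D,E)}=A^{(2)}_{\mathcal{R}(D), \mathcal{N}(E)}$.
   Context: $\mathbb{C}_{m,n}$ is the set of $m\times n$ complex matrices ($m,n\in\mathbb{N}$). For a matrix $M\in\mathbb{C}_{p,q}$, $\mathcal{R}(M)$ is its column space and $\mathcal{N}(M)=\{\mathbf{x}\in\mathbb{C}^q: M\mathbf{x}=\mathbf{0}\}$ its null space. For $A \in \mathbb{C}_{n,m}$ and $D,E \in \mathbb{C}_{m,n}$, $A$ is $(D,E)$-invertible if there exists $X\in\mathbb{C}_{m,n}$ such that $XAD=D$, $EAX=E$, $\mathcal{R}(X)\subseteq\mathcal{R}(D)$ and $\mathcal{N}(E)\subseteq\mathcal{N}(X)$. Such an $X$ is unique if it exists; it is called the $(D,E)$-inverse of $A$ and denoted $A^{\parallel (D,E)}$. For subspaces $\mathcal{T}\subseteq\mathbb{C}^m$ and $\mathcal{S}\subseteq\mathbb{C}^n$, $A^{(2)}_{\mathcal{T},\mathcal{S}}$ denotes the outer inverse of $A$ with range $\mathcal{T}$ and null space $\mathcal{S}$, i.e. the matrix $Z\in\mathbb{C}_{m,n}$ with $ZAZ=Z$, $\mathcal{R}(Z)=\mathcal{T}$ and $\mathcal{N}(Z)=\mathcal{S}$; it is unique when it exists. *)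

(* Defs.v *)
From mathcomp Require Import all_boot all_order all_algebra.
From mathcomp Require Import reals complex.

Set Implicit Arguments.
Unset Strict Implicit.
Unset Printing Implicit Defensive.

Import GRing.Theory.
Local Open Scope ring_scope.

(* A p x q matrix acts on column vectors by x |-> M *m x; its column space and
   null space are the image and the kernel of this linear map. *)
Definition mx_map (F : fieldType) (p q : nat) (M : 'M[F]_(p, q)) :
  'Hom('cV[F]_q, 'cV[F]_p) := linfun (mulmx M).

Definition col_space (F : fieldType) (p q : nat) (M : 'M[F]_(p, q)) :
  {vspace 'cV[F]_p} := limg (mx_map M).

Definition null_space (F : fieldType) (p q : nat) (M : 'M[F]_(p, q)) :
  {vspace 'cV[F]_q} := lker (mx_map M).

Lemma mx_mapE (F : fieldType) (p q : nat) (M : 'M[F]_(p, q)) (x : 'cV[F]_q) :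
  mx_map M x = M *m x.
Proof. by rewrite lfunE. Qed.

Lemma col_spaceP (F : fieldType) (p q : nat) (M : 'M[F]_(p, q))
    (y : 'cV[F]_p) :
  reflect (exists x : 'cV[F]_q, y = M *m x) (y \in col_space M).
Proof.
apply: (iffP memv_imgP) => [[x _ ->]|[x ->]]; exists x; rewrite ?mx_mapE //.
exact: memvf.
Qed.

Lemma null_spaceE (F : fieldType) (p q : nat) (M : 'M[F]_(p, q))
    (x : 'cV[F]_q) :
  (x \in null_space M) = (M *m x == 0).
Proof. by rewrite memv_ker mx_mapE. Qed.

Definition is_DE_inverse (F : fieldType) (m n : nat)
    (A : 'M[F]_(n, m)) (D E : 'M[F]_(m, n)) (X : 'M[F]_(m, n)) : Prop :=
  [/\ X *m A *m D = D,
      E *m A *m X = E,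
      (col_space X <= col_space D)%VS
    & (null_space E <= null_space X)%VS].

Definition DE_invertible (F : fieldType) (m n : nat)
    (A : 'M[F]_(n, m)) (D E : 'M[F]_(m, n)) : Prop :=
  exists X : 'M[F]_(m, n), is_DE_inverse A D E X.

(* Z is the outer inverse of A with range T and null space S. *)
Definition is_outer_inverse (F : fieldType) (m n : nat)
    (A : 'M[F]_(n, m)) (T : {vspace 'cV[F]_m}) (S : {vspace 'cV[F]_n})
    (Z : 'M[F]_(m, n)) : Prop :=
  [/\ Z *m A *m Z = Z, col_space Z = T & null_space Z = S].

(* Main.v *)
Require Import Defs.
From mathcomp Require Import all_boot all_order all_algebra.
From mathcomp Require Import reals complex.

(** Inclusions of column spaces and of null spaces are factorizations: the
    column space of [X] lies in that of [D] exactly when [X = D *m Q] for some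
    [Q], and the null space of [E] lies in that of [X] exactly when
    [X = P *m E] for some [P].  These factorizations turn each identity on one
    side of the equivalence into one on the other.  If [X *m A *m D = D] and
    [X = D *m Q], multiplying by [Q] gives [X *m A *m X = X], while
    [D = X *m (A *m D)] and [E = (E *m A) *m X] give the two missing
    inclusions.  Conversely, if [Z] is an outer inverse and [D = Z *m Q],
    [E = P *m Z], multiplying [Z *m A *m Z = Z] by [Q] on the right or by [P]
    on the left gives [Z *m A *m D = D] and [E *m A *m Z = E].

    Hence the same matrices are (D,E)-inverses and outer inverses with the
    prescribed range and null space ([is_DE_inverse_outer]); the final equality
    is then uniqueness of the (D,E)-inverse ([is_DE_inverse_unique]). *)

Local Open Scope ring_scope.

Section FactorizationAndInverses.

Set Implicit Arguments.
Unset Strict Implicit.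

Variable F : fieldType.

Lemma col_space_mul p q r (M : 'M[F]_(p, q)) (N : 'M[F]_(q, r)) :
  (col_space (M *m N) <= col_space M)%VS.
Proof.
apply/subvP=> y /col_spaceP[x ->]; apply/col_spaceP.
by exists (N *m x); rewrite mulmxA.
Qed.

Lemma null_space_mul p q r (M : 'M[F]_(p, q)) (N : 'M[F]_(q, r)) :
  (null_space N <= null_space (M *m N))%VS.
Proof.
apply/subvP=> x; rewrite !null_spaceE => /eqP Nx0.
by rewrite -mulmxA Nx0 mulmx0.
Qed.

(** Each column of [X] is a combination of the columns of [D]; the transposes
    let row-space inclusion collect the coefficients into one matrix. *)
Lemma col_space_sub_factor p q r (X : 'M[F]_(p, q)) (D : 'M[F]_(p, r)) :
  (col_space X <= col_space D)%VS -> exists Q, X = D *m Q.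
Proof.
move=> /subvP sXD.
suff /submxP[W defX] : (X^T <= D^T)%MS.
  by exists W^T; rewrite -[X]trmxK defX trmx_mul trmxK.
apply/row_subP=> j; rewrite -tr_col.
have /sXD /col_spaceP[y ->] : col j X \in col_space X.
  by apply/col_spaceP; exists (delta_mx j 0); rewrite colE.
by rewrite trmx_mul submxMl.
Qed.

(** The columns of the cokernel matrix of [E] lie in the null space of [E],
    so [X] annihilates them too, which says that the rows of [X] are
    combinations of the rows of [E]. *)
Lemma null_space_sub_factor p q r (X : 'M[F]_(p, q)) (E : 'M[F]_(r, q)) :
  (null_space E <= null_space X)%VS -> exists P, X = P *m E.
Proof.
move=> /subvP sEX; apply/submxP; rewrite submxE.
apply/eqP/matrixP=> i j.
have /sEX : col j (cokermx E) \in null_space E.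
  by rewrite null_spaceE colE mulmxA mulmx_coker mul0mx.
rewrite null_spaceE colE mulmxA -colE => /eqP/colP/(_ i).
by rewrite !mxE.
Qed.

Lemma is_DE_inverse_outer m n (A : 'M[F]_(n, m)) (D E X : 'M[F]_(m, n)) :
  is_DE_inverse A D E X <->
  is_outer_inverse A (col_space D) (null_space E) X.
Proof.
split=> [[XAD EAX sXD sEX] | [XAX eXD eXE]].
  have [Q defX] := col_space_sub_factor sXD.
  split.
  - by rewrite {2}defX mulmxA XAD -defX.
  - by apply/eqP; rewrite eqEsubv sXD -{1}XAD -mulmxA col_space_mul.
  - by apply/eqP; rewrite eqEsubv sEX -{1}EAX null_space_mul.
split; [| |by rewrite eXD|by rewrite eXE].
- have [|Q ->] := @col_space_sub_factor _ _ _ D X; first by rewrite eXD.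
  by rewrite mulmxA XAX.
- have [|P ->] := @null_space_sub_factor _ _ _ E X; first by rewrite eXE.
  by rewrite -!mulmxA [X *m _]mulmxA XAX.
Qed.

(** Both inverses equal [Z *m A *m X]: write [X = D *m Q] and use
    [Z *m A *m D = D], or write [Z = P *m E] and use [E *m A *m X = E]. *)
Lemma is_DE_inverse_unique m n (A : 'M[F]_(n, m)) (D E X Z : 'M[F]_(m, n)) :
  is_DE_inverse A D E X -> is_DE_inverse A D E Z -> X = Z.
Proof.
move=> [_ EAX sXD _] [ZAD _ _ sEZ].
have [Q defX] := col_space_sub_factor sXD.
have [P defZ] := null_space_sub_factor sEZ.
transitivity (Z *m A *m X); first by rewrite defX mulmxA ZAD.
by rewrite defZ -[RHS](congr1 (mulmx P) EAX) !mulmxA.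
Qed.

End FactorizationAndInverses.

Theorem theorem7p1 (R : realType) (m n : nat)
    (A : 'M[R[i]]_(n, m)) (D E : 'M[R[i]]_(m, n)) :
  (DE_invertible A D E <->
   exists Z : 'M[R[i]]_(m, n),
     is_outer_inverse A (col_space D) (null_space E) Z) /\
  (forall X Z : 'M[R[i]]_(m, n),
     is_DE_inverse A D E X ->
     is_outer_inverse A (col_space D) (null_space E) Z ->
     X = Z).
Proof.
split.
  by split=> -[X invX]; exists X; apply/is_DE_inverse_outer.
move=> X Z invX /is_DE_inverse_outer; exact: is_DE_inverse_unique.
Qed.
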